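(* Let $\Sigma$ be a cyclic surface in $\mathbb{R}^3$ with constant anisotropic mean curvature $\Lambda$ for the Dirichlet energy. If $\Lambda\neq 0$, then the planes of the foliation must be parallel. In addition, if these planes are parallel to the $xy$-plane, then $\Sigma$ is a surface of revolution.
   Context: Let $\Sigma$ be an oriented surface immersed in Euclidean space $\mathbb{R}^3$ (coordinates $(x,y,z)$) with unit normal $\nu=(\nu_1,\nu_2,\nu_3)$. The Dirichlet energy of $\Sigma$ is $\mathcal{F}(\Sigma)=\int_\Sigma F(\nu)\,d\Sigma$ with $F(\nu)=\frac{1}{\nu_3}-\nu_3$, defined where $\nu_3\neq 0$; if $\Sigma$ is the graph $z=u(x,y)$ over $\Omega\subset\mathbb{R}^2$, this equals $\int_\Omega |Du|^2$. The anisotropic mean curvature of $\Sigma$ is $\Lambda=2HF-\mathrm{div}_\Sigma DF$, where $H$ is the mean curvature of $\Sigma$ and $DF$ is the gradient of $F$ on the unit sphere $\mathbb{S}^2$. $\Sigma$ is a CAMC (stationary) surface if $\Lambda$ is constant. Concretely, near each point with $\nu_3\neq 0$ the surface is a graph $z=u(x,y)$, and the condition of having constant anisotropic mean curvature $\Lambda$ reads $u_{xx}+u_{yy}=\Lambda/2$. Convention: isolated points or curves where $\nu_3=0$ are allowed, but $\nu_3$ does not vanish identically on any nonempty open subset of $\Sigma$, and the condition on $\Lambda$ is required at the points with $\nu_3\neq 0$. A surface of $\mathbb{R}^3$ is a cyclic surface if it is foliated by a smooth one-parameter family of circles (not necessarily of the same radius); the planes containing these circles are called the planes of the foliation. *)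

(* Defs.v *)
From Stdlib Require Import Reals.
From Coquelicot Require Import Coquelicot.
Open Scope R_scope.

Definition R3 : Type := (R * R * R)%type.

Definition c1 (p : R3) : R := fst (fst p).
Definition c2 (p : R3) : R := snd (fst p).
Definition c3 (p : R3) : R := snd p.

Definition v0 : R3 := (0, 0, 0).
Definition ez : R3 := (0, 0, 1).
Definition vadd (p q : R3) : R3 := (c1 p + c1 q, c2 p + c2 q, c3 p + c3 q).
Definition vsub (p q : R3) : R3 := (c1 p - c1 q, c2 p - c2 q, c3 p - c3 q).
Definition vscal (k : R) (p : R3) : R3 := (k * c1 p, k * c2 p, k * c3 p).
Definition dot (p q : R3) : R := c1 p * c1 q + c2 p * c2 q + c3 p * c3 q.
Definition cross (p q : R3) : R3 :=
  (c2 p * c3 q - c3 p * c2 q,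
   c3 p * c1 q - c1 p * c3 q,
   c1 p * c2 q - c2 p * c1 q).
Definition vnorm (p : R3) : R := sqrt (dot p p).

Definition vDerive (f : R -> R3) (t : R) : R3 :=
  (Derive (fun u => c1 (f u)) t,
   Derive (fun u => c2 (f u)) t,
   Derive (fun u => c3 (f u)) t).

(** Open intervals, possibly unbounded. *)
Definition open_itv (a b : Rbar) (s : R) : Prop := Rbar_lt a s /\ Rbar_lt s b.

Definition smooth_on (D : R -> Prop) (f : R -> R) : Prop :=
  forall (n : nat) (s : R), D s -> ex_derive_n f n s.

Definition vsmooth_on (D : R -> Prop) (f : R -> R3) : Prop :=
  smooth_on D (fun s => c1 (f s)) /\
  smooth_on D (fun s => c2 (f s)) /\
  smooth_on D (fun s => c3 (f s)).

(** * Parametrized surfaces [X : R -> R -> R3] *)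

Definition Ds (X : R -> R -> R3) (s t : R) : R3 := vDerive (fun s' => X s' t) s.
Definition Dt (X : R -> R -> R3) (s t : R) : R3 := vDerive (fun t' => X s t') t.

(** Coefficients of the first fundamental form. *)
Definition gE (X : R -> R -> R3) (s t : R) : R := dot (Ds X s t) (Ds X s t).
Definition gF (X : R -> R -> R3) (s t : R) : R := dot (Ds X s t) (Dt X s t).
Definition gG (X : R -> R -> R3) (s t : R) : R := dot (Dt X s t) (Dt X s t).
Definition gdet (X : R -> R -> R3) (s t : R) : R :=
  gE X s t * gG X s t - gF X s t ^ 2.

Definition immersed_at (X : R -> R -> R3) (s t : R) : Prop :=
  cross (Ds X s t) (Dt X s t) <> v0.

Definition nu (X : R -> R -> R3) (s t : R) : R3 :=
  let N := cross (Ds X s t) (Dt X s t) in vscal (/ vnorm N) N.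

(** Half the trace of the second fundamental form [<d^2 X, nu>], so that
    [2 H = - div nu]; on a graph [z = u(x,y)] with upward normal,
    [2 H = div (Du / sqrt (1 + |Du|^2))]. *)
Definition mean_curvature (X : R -> R -> R3) (s t : R) : R :=
  let L := dot (Ds (Ds X) s t) (nu X s t) in
  let M := dot (Ds (Dt X) s t) (nu X s t) in
  let N := dot (Dt (Dt X) s t) (nu X s t) in
  (L * gG X s t - 2 * M * gF X s t + N * gE X s t) / (2 * gdet X s t).

(** Divergence along [X] of an R^3-valued field [V] : the contraction
    [g^ij <d_i V, d_j X>]. *)
Definition surface_div (X V : R -> R -> R3) (s t : R) : R :=
  (gG X s t * dot (Ds V s t) (Ds X s t)
   - gF X s t * (dot (Ds V s t) (Dt X s t) + dot (Dt V s t) (Ds X s t))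
   + gE X s t * dot (Dt V s t) (Dt X s t)) / gdet X s t.

(** * The Dirichlet energy *)

Definition grad (f : R3 -> R) (p : R3) : R3 :=
  (Derive (fun x => f (x, c2 p, c3 p)) (c1 p),
   Derive (fun y => f (c1 p, y, c3 p)) (c2 p),
   Derive (fun z => f (c1 p, c2 p, z)) (c3 p)).

(** Gradient on the unit sphere of the restriction of [f], at a point [p] of the
    sphere: the tangential part of the Euclidean gradient. *)
Definition sphere_grad (f : R3 -> R) (p : R3) : R3 :=
  vsub (grad f p) (vscal (dot (grad f p) p) p).

Definition dirichlet_density (p : R3) : R := / c3 p - c3 p.

(** [2 H F(nu) - div DF(nu)].  Since the density [F] is odd, the value is the
    same for both orientations [nu] and [- nu]. *)
Definition anisotropic_mean_curvature (X : R -> R -> R3) (s t : R) : R :=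
  2 * mean_curvature X s t * dirichlet_density (nu X s t)
  - surface_div X (fun s' t' => sphere_grad dirichlet_density (nu X s' t')) s t.

(** The second component says that no nonempty open piece of the surface over
    [D * R] has [nu_3] identically zero. *)
Definition constant_anisotropic_mean_curvature
    (D : R -> Prop) (X : R -> R -> R3) (Lambda : R) : Prop :=
  (forall s t, D s -> c3 (nu X s t) <> 0 ->
     anisotropic_mean_curvature X s t = Lambda) /\
  (forall s t, D s -> ~ locally_2d (fun s' t' => c3 (nu X s' t') = 0) s t).

(** * Cyclic surfaces *)

(** [t |-> circles c r e1 e2 s t] runs over the circle with centre [c s] and
    radius [r s] in the plane through [c s] directed by [e1 s] and [e2 s]. *)
Definition circles (c : R -> R3) (r : R -> R) (e1 e2 : R -> R3) (s t : R) : R3 :=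
  vadd (c s)
    (vscal (r s) (vadd (vscal (cos t) (e1 s)) (vscal (sin t) (e2 s)))).

Record cyclic_surface (D : R -> Prop)
    (c : R -> R3) (r : R -> R) (e1 e2 : R -> R3) : Prop := {
  cyclic_smooth_center : vsmooth_on D c;
  cyclic_smooth_radius : smooth_on D r;
  cyclic_smooth_e1 : vsmooth_on D e1;
  cyclic_smooth_e2 : vsmooth_on D e2;
  cyclic_radius_pos : forall s, D s -> 0 < r s;
  cyclic_orthonormal : forall s, D s ->
    dot (e1 s) (e1 s) = 1 /\ dot (e2 s) (e2 s) = 1 /\ dot (e1 s) (e2 s) = 0;
  cyclic_immersed : forall s t, D s -> immersed_at (circles c r e1 e2) s t
}.

Definition plane_normal (e1 e2 : R -> R3) (s : R) : R3 := cross (e1 s) (e2 s).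

(** Planes are parallel when their normals are collinear; coincident planes are
    parallel. *)
Definition parallel_planes (D : R -> Prop) (e1 e2 : R -> R3) : Prop :=
  forall s s', D s -> D s' ->
    cross (plane_normal e1 e2 s) (plane_normal e1 e2 s') = v0.

Definition planes_parallel_to_xy (D : R -> Prop) (e1 e2 : R -> R3) : Prop :=
  forall s, D s -> cross (plane_normal e1 e2 s) ez = v0.

(** Rotation by the angle [phi] about the line through [p] directed by the unit
    vector [w] (Rodrigues' formula). *)
Definition rotation (p w : R3) (phi : R) (q : R3) : R3 :=
  let d := vsub q p in
  vadd p (vadd (vadd (vscal (cos phi) d) (vscal (sin phi) (cross w d)))
               (vscal ((1 - cos phi) * dot w d) w)).

Definition surface_of_revolution (S : R3 -> Prop) : Prop :=
  exists p w : R3, dot w w = 1 /\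
    forall (phi : R) (q : R3), S q -> S (rotation p w phi q).

Definition trace_of (D : R -> Prop) (X : R -> R -> R3) (q : R3) : Prop :=
  exists s t : R, D s /\ q = X s t.

(* Main.v *)
From Pilot Require Import Defs.
From Stdlib Require Import Reals Lra Lia List Classical.
From Coquelicot Require Import Coquelicot.
(* Reals has a projection [c1] that would hide the coordinate [c1]. *)
Import Pilot.Defs.
Import ListNotations.
Open Scope R_scope.

(** Write [N = X_s x X_t] and let [(h_ij)] be the metric of the horizontal
    projection of [X].  Where [N_3 <> 0], constant anisotropic mean curvature
    means [2 Q = Lambda N_3^3] with
    [Q = h_tt <X_ss,N> - 2 h_st <X_st,N> + h_ss <X_tt,N>], so that
    [N_3 (2 Q - Lambda N_3^3) = 0] for all [t].  For a fixed circle everything is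
    a trigonometric polynomial in [t]: [N_3] has degree 2 and [Q] degree at
    most 5, hence the left-hand side has degree-8 coefficient
    [- Lambda w^4], with [w] the leading coefficient of [N_3].  So [w = 0], which
    says that the plane of the circle is horizontal or its normal [n] has [n' = 0];
    this forces [n] to be constant.  When all planes are horizontal, [N_3] has
    degree 1 and [Q] degree at most 1, and the same argument makes the
    leading coefficient of [N_3] vanish, i.e. the centres have no horizontal
    velocity. *)

(** * The anisotropic mean curvature of a parametrized surface *)

Definition is_vderive (f : R -> R3) (u : R) (l : R3) : Prop :=
  is_derive (fun x => c1 (f x)) u (c1 l) /\
  is_derive (fun x => c2 (f x)) u (c2 l) /\
  is_derive (fun x => c3 (f x)) u (c3 l).

Lemma vDerive_unique (f : R -> R3) (u : R) (l : R3) :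
  is_vderive f u l -> vDerive f u = l.
Proof.
destruct l as [[l1 l2] l3]; intros [H1 [H2 H3]].
unfold vDerive; f_equal; [f_equal|]; apply is_derive_unique; assumption.
Qed.

Lemma is_vderive_ext_loc (f g : R -> R3) (u : R) (l : R3) :
  locally u (fun x => f x = g x) -> is_vderive f u l -> is_vderive g u l.
Proof.
intros H [H1 [H2 H3]]; split; [|split];
  (eapply is_derive_ext_loc; [|eassumption]);
  (eapply filter_imp; [|exact H]); intros x E; simpl; now rewrite E.
Qed.

(** The eta-expanded left-hand side is the form in which [auto_derive] leaves the derivatives of
    abstract functions. *)
Lemma Derive_eq (f : R -> R) (u l : R) :
  is_derive f u l -> Derive (fun x => f x) u = l.
Proof. apply is_derive_unique. Qed.

(** The derivative is grouped so as to be convertible with a coordinate of the sum of cross products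
    in [is_vderive_cross]. *)
Lemma is_derive_det (a b c d : R -> R) (u a' b' c' d' : R) :
  is_derive a u a' -> is_derive b u b' ->
  is_derive c u c' -> is_derive d u d' ->
  is_derive (fun x => a x * b x - c x * d x) u
    (a' * b u - c' * d u + (a u * b' - c u * d')).
Proof.
intros A B C D; auto_derive; [repeat split; eexists; eassumption|].
rewrite (Derive_eq _ _ _ A), (Derive_eq _ _ _ B),
  (Derive_eq _ _ _ C), (Derive_eq _ _ _ D); ring.
Qed.

Lemma is_vderive_cross (f g : R -> R3) (u : R) (f' g' : R3) :
  is_vderive f u f' -> is_vderive g u g' ->
  is_vderive (fun x => cross (f x) (g x)) u
    (vadd (cross f' (g u)) (cross (f u) g')).
Proof.
intros [F1 [F2 F3]] [G1 [G2 G3]]; split; [|split].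
- exact (is_derive_det _ _ _ _ _ _ _ _ _ F2 G3 F3 G2).
- exact (is_derive_det _ _ _ _ _ _ _ _ _ F3 G1 F1 G3).
- exact (is_derive_det _ _ _ _ _ _ _ _ _ F1 G2 F2 G1).
Qed.

Lemma dot_pos (N : R3) : c3 N <> 0 -> 0 < dot N N.
Proof. intros H; unfold dot; nra. Qed.

Lemma vnorm_sqr (N : R3) : vnorm N * vnorm N = dot N N.
Proof. apply sqrt_sqrt; unfold dot; nra. Qed.

Lemma vnorm_pos (N : R3) : c3 N <> 0 -> 0 < vnorm N.
Proof. intros H; apply sqrt_lt_R0, dot_pos, H. Qed.

(** The density depends on the third coordinate alone, so its Euclidean gradient is vertical; in the
    tangential part only even powers of [vnorm N] survive. The result is rational in [N], and no
    square root has to be differentiated later. *)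
Lemma sphere_grad_dirichlet (N : R3) : c3 N <> 0 ->
  sphere_grad dirichlet_density (vscal (/ vnorm N) N) =
  vsub (vscal (/ c3 N + c3 N / dot N N) N)
       (vscal (1 + dot N N / c3 N ^ 2) ez).
Proof.
intros H3.
assert (Hn := vnorm_pos N H3); assert (Hn2 := vnorm_sqr N).
assert (Hn0 : vnorm N <> 0) by lra.
assert (Hg : grad dirichlet_density (vscal (/ vnorm N) N) =
  (0, 0, - (vnorm N ^ 2 / c3 N ^ 2) - 1)).
{ unfold grad, dirichlet_density.
  f_equal; [f_equal|]; [exact (Derive_const (dirichlet_density (vscal (/ vnorm N) N)) _)..|].
  apply is_derive_unique; unfold vscal, c3 at 1 2 3; simpl.
  auto_derive.
  - apply Rmult_integral_contrapositive_currified; [|exact H3].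
    apply Rinv_neq_0_compat; lra.
  - field; auto. }
unfold sphere_grad; rewrite Hg; clear Hg.
rewrite <- Hn2; revert Hn0 H3 Hn2; generalize (vnorm N); intros n Hn0 H3 Hn2.
destruct N as [[x y] z].
unfold dot, vsub, vscal, ez, c1, c2, c3 in *; simpl in *.
f_equal; [f_equal|]; try (field; auto).
Qed.

Lemma is_derive_dirichlet_coefficient (x y z : R -> R) (u x' y' z' : R) :
  is_derive x u x' -> is_derive y u y' -> is_derive z u z' -> z u <> 0 ->
  let d := x u * x u + y u * y u + z u * z u in
  let d' := 2 * (x u * x' + y u * y' + z u * z') in
  is_derive (fun v => / z v + z v / (x v * x v + y v * y v + z v * z v)) u
    (- (z' / z u ^ 2) + z' / d - z u * d' / d ^ 2) /\
  is_derive (fun v => 1 + (x v * x v + y v * y v + z v * z v) / z v ^ 2) u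
    (d' / z u ^ 2 - 2 * d * z' / z u ^ 3).
Proof.
intros X Y Z Hz d d'.
assert (Hd : d <> 0) by (unfold d; nra).
split; (auto_derive;
  [repeat split; try (eexists; eassumption); auto; apply pow_nonzero, Hz|]);
  rewrite (Derive_eq _ _ _ X), (Derive_eq _ _ _ Y), (Derive_eq _ _ _ Z);
  unfold d, d' in *; field; auto.
Qed.

Lemma is_derive_mul_sub_scal (k m f : R -> R) (i u k' m' f' : R) :
  is_derive k u k' -> is_derive m u m' -> is_derive f u f' ->
  is_derive (fun x => k x * f x - m x * i) u (k' * f u + k u * f' - m' * i).
Proof.
intros K M F; auto_derive; [repeat split; eexists; eassumption|].
rewrite (Derive_eq _ _ _ K), (Derive_eq _ _ _ M), (Derive_eq _ _ _ F); ring.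
Qed.

Lemma is_vderive_sub_scal (k m : R -> R) (f : R -> R3) (w : R3) (u k' m' : R) (f' : R3) :
  is_derive k u k' -> is_derive m u m' -> is_vderive f u f' ->
  is_vderive (fun x => vsub (vscal (k x) (f x)) (vscal (m x) w)) u
    (vsub (vadd (vscal k' (f u)) (vscal (k u) f')) (vscal m' w)).
Proof.
intros K M [F1 [F2 F3]].
split; [|split].
- exact (is_derive_mul_sub_scal _ _ _ (c1 w) _ _ _ _ K M F1).
- exact (is_derive_mul_sub_scal _ _ _ (c2 w) _ _ _ _ K M F2).
- exact (is_derive_mul_sub_scal _ _ _ (c3 w) _ _ _ _ K M F3).
Qed.

Lemma vDerive_sphere_grad_dirichlet (f : R -> R3) (u : R) (f' : R3) :
  is_vderive f u f' -> c3 (f u) <> 0 ->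
  vDerive (fun x => sphere_grad dirichlet_density (vscal (/ vnorm (f x)) (f x))) u =
  vsub
    (vadd (vscal (- (c3 f' / c3 (f u) ^ 2) + c3 f' / dot (f u) (f u)
                  - c3 (f u) * (2 * dot (f u) f') / dot (f u) (f u) ^ 2) (f u))
          (vscal (/ c3 (f u) + c3 (f u) / dot (f u) (f u)) f'))
    (vscal (2 * dot (f u) f' / c3 (f u) ^ 2
            - 2 * dot (f u) (f u) * c3 f' / c3 (f u) ^ 3) ez).
Proof.
intros [F1 [F2 F3]] H3.
assert (HD := dot_pos (f u) H3).
apply vDerive_unique.
apply is_vderive_ext_loc with
  (fun x => vsub (vscal (/ c3 (f x) + c3 (f x) / dot (f x) (f x)) (f x))
       (vscal (1 + dot (f x) (f x) / c3 (f x) ^ 2) ez)).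
(* The rational formula is available only where [c3 (f x)] is nonzero, which is an open condition by
   continuity. *)
{ assert (Hc : continuous (fun x => c3 (f x)) u)
    by (apply @ex_derive_continuous; eexists; exact F3).
  assert (Hl : locally u (fun x => c3 (f x) <> 0)).
  { apply (Hc (fun y => y <> 0)), (open_neq 0 _ H3). }
  eapply filter_imp; [|exact Hl].
  intros x Hx; symmetry; apply sphere_grad_dirichlet, Hx. }
destruct (is_derive_dirichlet_coefficient _ _ _ _ _ _ _ F1 F2 F3 H3) as [K M].
exact (is_vderive_sub_scal _ _ f ez u _ _ f' K M (conj F1 (conj F2 F3))).
Qed.

Definition hdot (p q : R3) : R := c1 p * c1 q + c2 p * c2 q.

(** For [p, q] the first and [pss, pst, ptt] the second derivatives of a
    parametrization of a graph [z = u(x,y)], this is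
    [(u_xx + u_yy) * c3 (cross p q) ^ 3]. *)
Definition laplace_numerator (p q pss pst ptt : R3) : R :=
  let N := cross p q in
  hdot q q * dot pss N - 2 * hdot p q * dot pst N + hdot p p * dot ptt N.

Ltac coords := cbv beta iota delta
  [hdot dot cross vadd vsub vscal ez c1 c2 c3 fst snd].

Ltac vring := coords; apply (f_equal2 pair); [apply (f_equal2 pair)|]; ring.

(** By [sphere_grad_dirichlet] the field to differentiate is [k N - m ez]. As [N] is orthogonal to
    both tangent vectors, the derivatives of [k] drop out of the divergence, and all that is left is
    linear in the products of [pss], [pst], [ptt] with [N]. The identity [Key] then trades the full
    metric for the horizontal one. Equality of mixed derivatives enters through the single vector
    [pst]. *)
Lemma anisotropic_mean_curvature_laplace (X : R -> R -> R3) (s t : R)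
    (pss pst ptt : R3) :
  is_vderive (fun u => Ds X u t) s pss ->
  is_vderive (fun u => Ds X s u) t pst ->
  is_vderive (fun u => Dt X u t) s pst ->
  is_vderive (fun u => Dt X s u) t ptt ->
  let N := cross (Ds X s t) (Dt X s t) in
  c3 N <> 0 ->
  anisotropic_mean_curvature X s t * c3 N ^ 3 =
  2 * laplace_numerator (Ds X s t) (Dt X s t) pss pst ptt.
Proof.
intros Hss Hst Hts Htt N H3.
assert (HVs := vDerive_sphere_grad_dirichlet _ _ _
  (is_vderive_cross _ _ _ _ _ Hss Hts) H3).
assert (HVt := vDerive_sphere_grad_dirichlet _ _ _
  (is_vderive_cross _ _ _ _ _ Hst Htt) H3).
cbv beta in HVs, HVt.
assert (HD := dot_pos N H3); assert (Hn := vnorm_pos N H3).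
assert (Hn2 := vnorm_sqr N).
unfold anisotropic_mean_curvature, mean_curvature, surface_div.
change (Ds (fun s' t' => sphere_grad dirichlet_density (nu X s' t')) s t)
  with (vDerive (fun x => sphere_grad dirichlet_density
    (vscal (/ vnorm (cross (Ds X x t) (Dt X x t))) (cross (Ds X x t) (Dt X x t)))) s).
change (Dt (fun s' t' => sphere_grad dirichlet_density (nu X s' t')) s t)
  with (vDerive (fun x => sphere_grad dirichlet_density
    (vscal (/ vnorm (cross (Ds X s x) (Dt X s x))) (cross (Ds X s x) (Dt X s x)))) t).
rewrite HVs, HVt; clear HVs HVt.
change (Ds (Ds X) s t) with (vDerive (fun u => Ds X u t) s).
change (Ds (Dt X) s t) with (vDerive (fun u => Dt X u t) s).
change (Dt (Dt X) s t) with (vDerive (fun u => Dt X s u) t).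
rewrite (vDerive_unique _ _ _ Hss), (vDerive_unique _ _ _ Hts),
  (vDerive_unique _ _ _ Htt).
clear Hss Hst Hts Htt.
unfold nu, gdet, gE, gF, gG; fold N.
change (cross (Ds X s t) (Dt X s t)) with N.
unfold laplace_numerator; fold N.
revert N H3 HD Hn Hn2; generalize (Ds X s t), (Dt X s t).
intros p q N H3 HD Hn Hn2.
(* [Ns] and [Nt] are the derivatives of [N]; [h11], [h12], [h22] are the coefficients of the second
   fundamental form before division by [vnorm N]. *)
set (Ns := vadd (cross pss q) (cross p pst)).
set (Nt := vadd (cross pst q) (cross p ptt)).
set (h11 := dot pss N); set (h12 := dot pst N); set (h22 := dot ptt N).
assert (Hdet : dot p p * dot q q - dot p q ^ 2 = dot N N)
  by (unfold N; coords; ring).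
(* The left-hand side is the third coordinate of [N x (N x Ns)], and [N x Ns = h12 p - h11 q]
   because [Ns] has products [- h11] and [- h12] with [p] and [q]. The same holds for [Nt] below.
   These combinations are the numerators of the derivatives of [m]. *)
assert (Es : dot N Ns * c3 N - dot N N * c3 Ns =
  h12 * c3 (cross N p) - h11 * c3 (cross N q))
  by (unfold h11, h12, Ns, N; coords; ring).
assert (Et : dot N Nt * c3 N - dot N N * c3 Nt =
  h22 * c3 (cross N p) - h12 * c3 (cross N q))
  by (unfold h12, h22, Nt, N; coords; ring).
assert (Hdot : forall k k' m (M v : R3),
  dot (vsub (vadd (vscal k' N) (vscal k M)) (vscal m ez)) v =
  k' * dot N v + k * dot M v - m * c3 v) by (intros; coords; ring).
rewrite !Hdot.
assert (HNp : dot N p = 0) by (unfold N; coords; ring).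
assert (HNq : dot N q = 0) by (unfold N; coords; ring).
assert (Hsp : dot Ns p = - h11) by (unfold Ns, h11, N; coords; ring).
assert (Hsq : dot Ns q = - h12) by (unfold Ns, h12, N; coords; ring).
assert (Htp : dot Nt p = - h12) by (unfold Nt, h12, N; coords; ring).
assert (Htq : dot Nt q = - h22) by (unfold Nt, h22, N; coords; ring).
rewrite HNp, HNq, Hsp, Hsq, Htp, Htq, Hdet.
assert (Hh : forall v, dot v (vscal (/ vnorm N) N) = dot v N / vnorm N)
  by (intros v; coords; unfold Rdiv; ring).
rewrite !Hh; fold h11 h12 h22.
unfold dirichlet_density.
replace (c3 (vscal (/ vnorm N) N)) with (c3 N / vnorm N)
  by (coords; unfold Rdiv; ring).
assert (Hk : forall M, 2 * dot N M / c3 N ^ 2 - 2 * dot N N * c3 M / c3 N ^ 3 =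
  2 * (dot N M * c3 N - dot N N * c3 M) / c3 N ^ 3) by (intros; field; auto).
rewrite !Hk, Es, Et.
(* Both sides are linear in [h11], [h12], [h22] with coefficients polynomial in [p] and [q], so
   these three numbers can be made arbitrary. *)
assert (Key : c3 N ^ 2 * (dot q q * h11 - 2 * dot p q * h12 + dot p p * h22)
  + (dot q q * c3 p * (h12 * c3 (cross N p) - h11 * c3 (cross N q))
     - dot p q * (c3 q * (h12 * c3 (cross N p) - h11 * c3 (cross N q))
        + c3 p * (h22 * c3 (cross N p) - h12 * c3 (cross N q)))
     + dot p p * c3 q * (h22 * c3 (cross N p) - h12 * c3 (cross N q))) =
  dot N N * (hdot q q * h11 - 2 * hdot p q * h12 + hdot p p * h22)).
{ generalize h11 h12 h22; intros a b c; unfold N; coords; ring. }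
assert (HD0 : dot N N <> 0) by lra.
apply (Rmult_eq_reg_l (dot N N)); [|exact HD0].
transitivity (2 * (dot N N * (hdot q q * h11 - 2 * hdot p q * h12 + hdot p p * h22)));
  [|ring].
rewrite <- Key; clear Key Hdet Es Et Hk Hh Hdot HNp HNq Hsp Hsq Htp Htq HD.
revert Hn2 HD0 H3 Hn; generalize (dot N N) (vnorm N) (c3 N); intros D n z <- HD0 Hz Hn.
field; repeat split; auto; lra.
Qed.

(** * Trigonometric polynomials *)

Definition peval (l : list C) (z : C) : C :=
  fold_right (fun a v => (a + z * v)%C) (RtoC 0) l.

(** The bound on the length controls the degree of the quotient in [peval_div], hence the induction
    on the number of roots. *)
Lemma peval_lin (k : C) (l m : list C) :
  exists q, (length q <= Nat.max (length l) (length m))%nat /\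
    forall z, peval q z = (peval l z + k * peval m z)%C.
Proof.
revert m; induction l as [|a l IH]; intros m.
- exists (map (Cmult k) m); split; [rewrite length_map; simpl; lia|].
  intros z; induction m as [|b m IHm]; simpl; [ring|].
  simpl in IHm; rewrite IHm; ring.
- destruct m as [|b m].
  + exists (a :: l); split; [simpl; lia|]; intros z; simpl; ring.
  + destruct (IH m) as [q [Hq Hz]].
    exists ((a + k * b)%C :: q); split; [simpl; lia|].
    intros z; simpl; rewrite Hz; ring.
Qed.

Lemma peval_mul (l m : list C) :
  exists q, forall z, peval q z = (peval l z * peval m z)%C.
Proof.
induction l as [|a l [q IH]].
- exists []; intros z; simpl; ring.
- destruct (peval_lin a (RtoC 0 :: q) m) as [q' [_ H]].
  exists q'; intros z; rewrite H; simpl; rewrite IH; ring.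
Qed.

(** If [q] is the quotient for [l], then the quotient for [a + z l] is [l + w q], which is no longer
    than [l]. *)
Lemma peval_div (l : list C) (w : C) :
  exists q, (length q <= pred (length l))%nat /\
    forall z, peval l z = (peval l w + (z - w) * peval q z)%C.
Proof.
induction l as [|a l [q [Hq IH]]].
- exists []; split; [simpl; lia|]; intros z; simpl; ring.
- destruct (peval_lin w l q) as [q' [Hl H]].
  exists q'; split; [simpl; lia|].
  intros z; rewrite H; simpl; rewrite (IH z); ring.
Qed.

Lemma peval_infinite_roots (l : list C) (a : nat -> C) :
  (forall j k, a j = a k -> j = k) ->
  (forall k, peval l (a k) = RtoC 0) -> forall z, peval l z = RtoC 0.
Proof.
remember (length l) as n eqn:Hn.
(* Division only bounds the length of the quotient, so the induction runs on an upper bound. *)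
assert (Hl : (length l <= n)%nat) by lia; clear Hn.
revert l a Hl; induction n as [|n IH]; intros l a Hl Hinj Hroot z.
- destruct l; [reflexivity|simpl in Hl; lia].
- destruct (peval_div l (a O)) as [q [Hq Hdiv]].
  rewrite Hdiv, Hroot, (IH q (fun k => a (S k))); [ring|lia| |].
  + intros j k E; apply Hinj in E; lia.
  + intros k.
    destruct (Ceq_dec (peval q (a (S k))) (RtoC 0)) as [E|E]; [exact E|].
    exfalso.
    assert (Hd : (a (S k) - a O)%C <> RtoC 0).
    { intros E'. assert (H0 : a (S k) = a O).
      { replace (a (S k)) with ((a (S k) - a O) + a O)%C by ring.
        rewrite E'; ring. }
      apply Hinj in H0; lia. }
    apply (Cmult_neq_0 _ _ Hd E).
    generalize (Hdiv (a (S k))); rewrite !Hroot; intros H.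
    rewrite H; ring.
Qed.

Definition expi (t : R) : C := (cos t, sin t).

(** [f] is a trigonometric polynomial of degree at most [n] in which
    [exp (- i n t)] has coefficient [w]: multiplying by [exp (i n t)] gives a
    polynomial in [exp (i t)], and [w] is its constant term. *)
Definition trigpoly (n : nat) (w : C) (f : R -> R) : Prop :=
  exists l, peval l (RtoC 0) = w /\
    forall t, (Cpow (expi t) n * RtoC (f t))%C = peval l (expi t).

(** The associated polynomial vanishes on infinitely many points of the unit circle, hence also at
    0, where its value is [w]. The points have arguments [atan (INR k)], which are told apart by
    their tangents. *)
Lemma trigpoly_zero (n : nat) (w : C) (f : R -> R) :
  trigpoly n w f -> (forall t, f t = 0) -> w = RtoC 0.
Proof.
intros [l [<- Hl]] Hf.
apply (peval_infinite_roots l (fun k => expi (atan (INR k)))).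
- intros j k E; injection E; intros Es Ec.
  apply INR_eq; rewrite <- (tan_atan (INR j)), <- (tan_atan (INR k)).
  unfold tan; rewrite Es, Ec; reflexivity.
- intros k; rewrite <- Hl, Hf; ring.
Qed.

Lemma trigpoly_ext (n : nat) (w : C) (f g : R -> R) :
  (forall t, f t = g t) -> trigpoly n w f -> trigpoly n w g.
Proof.
intros H [l [Hw Hl]]; exists l; split; [exact Hw|].
intros t; rewrite <- H; apply Hl.
Qed.

Lemma trigpoly_affine (k0 k1 k2 : R) :
  trigpoly 1 (k1 / 2, k2 / 2) (fun t => k0 + k1 * cos t + k2 * sin t).
Proof.
(* With [z = exp (i t)], [z cos t = (1 + z^2) / 2] and [z sin t = i (1 - z^2) / 2]. *)
exists [(k1 / 2, k2 / 2); RtoC k0; (k1 / 2, - k2 / 2)]; split.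
- simpl; ring.
- intros t; assert (H := sin2_cos2 t); unfold Rsqr in H.
  unfold expi; simpl; apply injective_projections; simpl.
  + replace (k1 / 2) with (k1 / 2 * (sin t * sin t + cos t * cos t))
      at 1 by (rewrite H; ring); field.
  + replace (k2 / 2) with (k2 / 2 * (sin t * sin t + cos t * cos t))
      at 1 by (rewrite H; ring); field.
Qed.

(** Read in one degree higher, the extreme coefficient is zero; this is how a term of lower degree
    drops out of a comparison of leading coefficients. *)
Lemma trigpoly_S (n : nat) (w : C) (f : R -> R) :
  trigpoly n w f -> trigpoly (S n) (RtoC 0) f.
Proof.
intros [l [_ Hl]]; exists (RtoC 0 :: l); split; [simpl; ring|].
intros t; simpl; rewrite <- Hl; ring.
Qed.

Lemma trigpoly_lin (n : nat) (k : R) (w z : C) (f g : R -> R) :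
  trigpoly n w f -> trigpoly n z g ->
  trigpoly n (w + RtoC k * z)%C (fun t => f t + k * g t).
Proof.
intros [l [Hw Hl]] [m [Hz Hm]].
destruct (peval_lin (RtoC k) l m) as [q [_ Hq]].
exists q; split; [now rewrite Hq, Hw, Hz|].
intros t; rewrite Hq, <- Hl, <- Hm, RtoC_plus, RtoC_mult; ring.
Qed.

Lemma trigpoly_mul (n m : nat) (w z : C) (f g : R -> R) :
  trigpoly n w f -> trigpoly m z g ->
  trigpoly (n + m) (w * z)%C (fun t => f t * g t).
Proof.
intros [l [Hw Hl]] [l' [Hz Hl']].
destruct (peval_mul l l') as [q Hq].
exists q; split; [now rewrite Hq, Hw, Hz|].
intros t; rewrite Hq, <- Hl, <- Hl', RtoC_mult, Cpow_add_r; ring.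
Qed.

(* Up to a factor, the top coefficient of the vanishing product is [w ^ 4]. *)
Lemma trigpoly_cube_lead (m : nat) (w z : C) (k : R) (N Q : R -> R) :
  k <> 0 -> trigpoly m w N -> trigpoly (pred (3 * m)) z Q -> (0 < m)%nat ->
  (forall t, N t * (2 * Q t - k * N t ^ 3) = 0) -> w = RtoC 0.
Proof.
intros Hk HN HQ Hm H.
(* Read in degree [3 * m], the degree of [N ^ 3], the function [Q] contributes the coefficient 0.
   Positivity of [m] makes the successor of [pred (3 * m)] equal to [3 * m]. *)
apply trigpoly_S in HQ.
replace (S (pred (3 * m))) with (m + (m + m))%nat in HQ by lia.
assert (HN3 := trigpoly_mul _ _ _ _ _ _ HN (trigpoly_mul _ _ _ _ _ _ HN HN)).
assert (HD := trigpoly_lin _ (- k / 2) _ _ _ _ HQ HN3).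
apply (trigpoly_mul _ _ _ _ _ _ HN), trigpoly_zero in HD.
2: { intros t; specialize (H t).
  replace 0 with (/ 2 * (N t * (2 * Q t - k * N t ^ 3))) by (rewrite H; ring).
  field. }
destruct (Ceq_dec w (RtoC 0)) as [E|E]; [exact E|exfalso].
revert HD; replace (w * (RtoC 0 + RtoC (- k / 2) * (w * (w * w))))%C
  with (RtoC (- k / 2) * (w * (w * (w * w))))%C by ring.
repeat apply Cmult_neq_0; auto.
intros E'; apply RtoC_inj in E'; lra.
Qed.

(** The extreme coefficient of [Q] never matters, only its degree, so it is hidden here. *)
Definition trigdeg (n : nat) (f : R -> R) : Prop := exists w, trigpoly n w f.

Lemma trigdeg_lin (n : nat) (k : R) (f g : R -> R) :
  trigdeg n f -> trigdeg n g -> trigdeg n (fun t => f t + k * g t).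
Proof. intros [w Hf] [z Hg]; eexists; apply trigpoly_lin; eassumption. Qed.

Lemma trigdeg_mul (n m : nat) (f g : R -> R) :
  trigdeg n f -> trigdeg m g -> trigdeg (n + m) (fun t => f t * g t).
Proof. intros [w Hf] [z Hg]; eexists; apply trigpoly_mul; eassumption. Qed.

Lemma trigdeg_ext (n : nat) (f g : R -> R) :
  (forall t, f t = g t) -> trigdeg n f -> trigdeg n g.
Proof. intros H [w Hf]; exists w; exact (trigpoly_ext n w f g H Hf). Qed.

Definition vtrigdeg (n : nat) (f : R -> R3) : Prop :=
  trigdeg n (fun t => c1 (f t)) /\ trigdeg n (fun t => c2 (f t)) /\
  trigdeg n (fun t => c3 (f t)).

Lemma trigdeg_det (n m : nat) (f g h k : R -> R) :
  trigdeg n f -> trigdeg m g -> trigdeg n h -> trigdeg m k ->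
  trigdeg (n + m) (fun t => f t * g t - h t * k t).
Proof.
intros F G H K; apply trigdeg_ext with (fun t => f t * g t + (-1) * (h t * k t)).
- intros t; ring.
- apply trigdeg_lin; apply trigdeg_mul; assumption.
Qed.

Lemma trigdeg_hdot (n m : nat) (f g : R -> R3) :
  vtrigdeg n f -> vtrigdeg m g -> trigdeg (n + m) (fun t => hdot (f t) (g t)).
Proof.
intros [F1 [F2 F3]] [G1 [G2 G3]].
apply trigdeg_ext with
  (fun t => c1 (f t) * c1 (g t) + 1 * (c2 (f t) * c2 (g t))).
- intros t; unfold hdot; ring.
- apply trigdeg_lin; apply trigdeg_mul; assumption.
Qed.

Lemma trigdeg_dot (n m : nat) (f g : R -> R3) :
  vtrigdeg n f -> vtrigdeg m g -> trigdeg (n + m) (fun t => dot (f t) (g t)).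
Proof.
intros F G.
apply trigdeg_ext with (fun t => hdot (f t) (g t) + 1 * (c3 (f t) * c3 (g t))).
- intros t; unfold hdot, dot; ring.
- apply trigdeg_lin; [apply trigdeg_hdot; assumption|].
  apply trigdeg_mul; [apply F|apply G].
Qed.

Lemma vtrigdeg_cross (n m : nat) (f g : R -> R3) :
  vtrigdeg n f -> vtrigdeg m g -> vtrigdeg (n + m) (fun t => cross (f t) (g t)).
Proof.
intros [F1 [F2 F3]] [G1 [G2 G3]].
split; [|split]; apply trigdeg_det; assumption.
Qed.

(** Each term is a horizontal product, of degree 2, times a product with [N], of degree 1 + 2. The
    total 5 is [pred (3 * 2)], as [trigpoly_cube_lead] demands when [N_3] has degree 2. *)
Lemma trigdeg_laplace_numerator (p q pss pst ptt : R -> R3) :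
  vtrigdeg 1 p -> vtrigdeg 1 q -> vtrigdeg 1 pss -> vtrigdeg 1 pst ->
  vtrigdeg 1 ptt ->
  trigdeg 5 (fun t => laplace_numerator (p t) (q t) (pss t) (pst t) (ptt t)).
Proof.
intros Hp Hq Hss Hst Htt.
assert (HN := vtrigdeg_cross _ _ _ _ Hp Hq).
assert (H : forall a b d, vtrigdeg 1 a -> vtrigdeg 1 b -> vtrigdeg 1 d ->
  trigdeg 5 (fun t => hdot (a t) (b t) * dot (d t) (cross (p t) (q t)))).
{ intros a b d Ha Hb Hd.
  exact (trigdeg_mul 2 3 _ _ (trigdeg_hdot 1 1 _ _ Ha Hb)
    (trigdeg_dot 1 2 _ _ Hd HN)). }
eapply trigdeg_ext; [|exact (trigdeg_lin _ 1 _ _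
  (trigdeg_lin _ (-2) _ _ (H _ _ _ Hq Hq Hss) (H _ _ _ Hp Hq Hst))
  (H _ _ _ Hp Hp Htt))].
intros t; unfold laplace_numerator; ring.
Qed.

(** * Moving orthonormal frames *)

Lemma is_derive_dot (f g : R -> R3) (s : R) (f' g' : R3) :
  is_vderive f s f' -> is_vderive g s g' ->
  is_derive (fun x => dot (f x) (g x)) s (dot f' (g s) + dot (f s) g').
Proof.
intros [F1 [F2 F3]] [G1 [G2 G3]].
assert (H : forall x1 x2 x3 y1 y2 y3 : R -> R, forall x1' x2' x3' y1' y2' y3',
  is_derive x1 s x1' -> is_derive x2 s x2' -> is_derive x3 s x3' ->
  is_derive y1 s y1' -> is_derive y2 s y2' -> is_derive y3 s y3' ->
  is_derive (fun u => x1 u * y1 u + x2 u * y2 u + x3 u * y3 u) s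
    (x1' * y1 s + x2' * y2 s + x3' * y3 s +
     (x1 s * y1' + x2 s * y2' + x3 s * y3'))).
{ intros x1 x2 x3 y1 y2 y3 x1' x2' x3' y1' y2' y3' X1 X2 X3 Y1 Y2 Y3.
  auto_derive; [repeat split; eexists; eassumption|].
  rewrite (Derive_eq _ _ _ X1), (Derive_eq _ _ _ X2), (Derive_eq _ _ _ X3),
    (Derive_eq _ _ _ Y1), (Derive_eq _ _ _ Y2), (Derive_eq _ _ _ Y3); ring. }
exact (H _ _ _ _ _ _ _ _ _ _ _ _ F1 F2 F3 G1 G2 G3).
Qed.

Lemma dot_constant_derive (D : R -> Prop) (f g : R -> R3) (s k : R) (f' g' : R3) :
  locally s D -> (forall x, D x -> dot (f x) (g x) = k) ->
  is_vderive f s f' -> is_vderive g s g' -> dot f' (g s) + dot (f s) g' = 0.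
Proof.
intros HD Hk Hf Hg.
rewrite <- (is_derive_unique _ _ _ (is_derive_dot _ _ _ _ _ Hf Hg)).
rewrite <- (Derive_const k s).
apply Derive_ext_loc; eapply filter_imp; [|exact HD]; exact Hk.
Qed.

Lemma is_vderive_scal (r : R -> R) (f : R -> R3) (s r' : R) (f' : R3) :
  is_derive r s r' -> is_vderive f s f' ->
  is_vderive (fun x => vscal (r x) (f x)) s
    (vadd (vscal r' (f s)) (vscal (r s) f')).
Proof.
intros Hr [F1 [F2 F3]].
split; [|split]; (apply @is_derive_mult; [assumption..|exact Rmult_comm]).
Qed.

Lemma cross_cross (u v w : R3) :
  cross u (cross v w) = vsub (vscal (dot u w) v) (vscal (dot u v) w).
Proof. vring. Qed.

Lemma cross_anti (u v : R3) : cross u v = vscal (-1) (cross v u).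
Proof. vring. Qed.

Lemma dot_sym (u v : R3) : dot u v = dot v u.
Proof. unfold dot; ring. Qed.

(** With [n = cross a b], the vector [n x (n x v)] is computed twice: directly it is
    [(n . v) n - v], and through [n x v = (v . a) b - (v . b) a] it is minus the projection of [v]
    to the plane of [a] and [b]. *)
Lemma orthonormal_expansion (a b v : R3) :
  dot a a = 1 -> dot b b = 1 -> dot a b = 0 ->
  v = vadd (vadd (vscal (dot v a) a) (vscal (dot v b) b))
           (vscal (dot v (cross a b)) (cross a b)).
Proof.
intros Ha Hb Hab.
assert (Hn : dot (cross a b) (cross a b) = 1).
{ transitivity (dot a a * dot b b - dot a b ^ 2); [coords; ring|].
  rewrite Ha, Hb, Hab; ring. }
assert (H := cross_cross (cross a b) (cross a b) v); rewrite Hn in H.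
assert (H' : cross (cross a b) (cross (cross a b) v) =
  vsub (vscal (- dot v a) a) (vscal (dot v b) b)).
{ assert (E : cross (cross a b) v = vsub (vscal (dot v a) b) (vscal (dot v b) a))
    by (rewrite cross_anti, cross_cross; vring).
  rewrite E.
  transitivity (vsub (vscal (dot v a) (cross (cross a b) b))
                     (vscal (dot v b) (cross (cross a b) a)));
    [vring|].
  rewrite !(cross_anti (cross a b)), !cross_cross, Ha, Hb, (dot_sym b a), Hab.
  vring. }
rewrite H' in H; clear H'; revert H Hn.
rewrite (dot_sym (cross a b) v).
generalize (cross a b) (dot v a) (dot v b) (dot v (cross a b)).
destruct a as [[a1 a2] a3], b as [[b1 b2] b3], v as [[v1 v2] v3].
intros [[n1 n2] n3] p q k H _; revert H; coords; intros H; injection H; intros.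
f_equal; [f_equal|]; lra.
Qed.

(** This is the third coordinate of the expansion of [ez] in the frame. *)
Lemma orthonormal_normal_z (a b : R3) :
  dot a a = 1 -> dot b b = 1 -> dot a b = 0 ->
  c3 (cross a b) ^ 2 = 1 - c3 a ^ 2 - c3 b ^ 2.
Proof.
intros Ha Hb Hab.
assert (H := f_equal c3 (orthonormal_expansion a b ez Ha Hb Hab)).
revert H; generalize (cross a b); intros n H.
transitivity (c3 (vadd (vadd (vscal (dot ez a) a) (vscal (dot ez b) b))
           (vscal (dot ez n) n)) - c3 a ^ 2 - c3 b ^ 2); [coords; ring|].
rewrite <- H; reflexivity.
Qed.

(** Orthonormality gives [a' = w b + p n] and [b' = - w a + q n] with [n = cross a b], hence
    [n' = - p a - q b]. The two conditions on third coordinates become [p a_3 = q b_3] and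
    [p b_3 = - q a_3], so [p] and [q] are both killed by [k = a_3^2 + b_3^2 = 1 - n_3^2]. For
    [k = 0] the plane is horizontal and [n'_3 = 0] holds because [a_3 = b_3 = 0]. *)
Lemma orthonormal_frame_derivative (a b a' b' : R3) :
  dot a a = 1 -> dot b b = 1 -> dot a b = 0 ->
  dot a' a = 0 -> dot b' b = 0 -> dot a' b + dot a b' = 0 ->
  c3 (vadd (cross a' b) (cross b' a)) = 0 ->
  c3 (vsub (cross b' b) (cross a' a)) = 0 ->
  let n' := vadd (cross a' b) (cross a b') in
  c3 n' = 0 /\ vscal (1 - c3 (cross a b) ^ 2) n' = v0.
Proof.
intros Ha Hb Hab Haa' Hbb' Hab' E1 E2 n'.
rewrite (orthonormal_normal_z a b Ha Hb Hab).
assert (Xa := orthonormal_expansion a b a' Ha Hb Hab).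
assert (Xb := orthonormal_expansion a b b' Ha Hb Hab).
rewrite Haa' in Xa; rewrite Hbb' in Xb.
replace (dot b' a) with (- dot a' b) in Xb by (rewrite (dot_sym b' a); lra).
revert n' E1 E2 Xa Xb; generalize (dot a' b) (dot a' (cross a b)) (dot b' (cross a b)).
intros w p q n' E1 E2 Xa Xb.
assert (Fa : cross a (cross a b) = vscal (-1) b)
  by (rewrite cross_cross, Ha, Hab; vring).
assert (Fb : cross b (cross a b) = a)
  by (rewrite cross_cross, Hb, (dot_sym b a), Hab; destruct a as [[? ?] ?];
      vring).
assert (Caa : cross a' a = vadd (vscal (- w) (cross a b)) (vscal p b)).
{ rewrite Xa.
  transitivity (vadd (vscal (- w) (cross a b)) (vscal (- p) (cross a (cross a b))));
    [vring|].
  rewrite Fa; vring. }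
assert (Cab : cross a' b = vscal (- p) a).
{ rewrite Xa.
  transitivity (vscal (- p) (cross b (cross a b)));
    [vring|now rewrite Fb]. }
assert (Cba : cross b' a = vscal q b).
{ rewrite Xb.
  transitivity (vscal (- q) (cross a (cross a b)));
    [vring|].
  rewrite Fa; vring. }
assert (Cbb : cross b' b = vadd (vscal (- w) (cross a b)) (vscal (- q) a)).
{ rewrite Xb.
  transitivity (vadd (vscal (- w) (cross a b)) (vscal (- q) (cross b (cross a b))));
    [vring|now rewrite Fb]. }
assert (Hn' : n' = vadd (vscal (- p) a) (vscal (- q) b)).
{ unfold n'; rewrite Cab, (cross_anti a b'), Cba.
  vring. }
rewrite Cab, Cba in E1; rewrite Cbb, Caa in E2; rewrite Hn'.
assert (E1' : p * c3 a = q * c3 b) by (revert E1; coords; lra).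
assert (E2' : p * c3 b = - (q * c3 a)).
{ revert E2; generalize (cross a b); intros n; coords; lra. }
set (k := c3 a ^ 2 + c3 b ^ 2).
assert (Hp : k * p = 0).
{ transitivity (c3 a * (p * c3 a) + c3 b * (p * c3 b)); [unfold k; ring|].
  rewrite E1', E2'; ring. }
assert (Hq : k * q = 0).
{ transitivity (c3 b * (q * c3 b) - c3 a * (- (q * c3 a))); [unfold k; ring|].
  rewrite <- E1', <- E2'; ring. }
split.
- destruct (Req_dec k 0) as [Hk|Hk].
  + assert (c3 a = 0) by (unfold k in Hk; nra).
    assert (c3 b = 0) by (unfold k in Hk; nra).
    transitivity (- p * c3 a + - q * c3 b); [reflexivity|].
    rewrite H, H0; ring.
  + apply Rmult_integral in Hp; apply Rmult_integral in Hq.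
    destruct Hp as [Hp|Hp], Hq as [Hq|Hq]; try easy.
    rewrite Hp, Hq; coords; ring.
- replace (1 - (1 - c3 a ^ 2 - c3 b ^ 2)) with k by (unfold k; ring).
  transitivity (vadd (vscal (- (k * p)) a) (vscal (- (k * q)) b));
    [vring|].
  rewrite Hp, Hq; unfold v0; vring.
Qed.

(** * Horizontal circles *)

(** For fixed [s], a circle of the family and all its derivatives in [s] and [t] have this form. *)
Definition harmonic (z x y : R3) (t : R) : R3 :=
  vadd z (vadd (vscal (cos t) x) (vscal (sin t) y)).

Lemma constant_on_convex (D : R -> Prop) (f : R -> R) :
  (forall x y z, D x -> D y -> x <= z <= y -> D z) ->
  (forall s, D s -> is_derive f s 0) ->
  forall x y, D x -> D y -> f x = f y.
Proof.
intros HD Hf.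
assert (H : forall x y, D x -> D y -> x < y -> f x = f y).
{ intros x y Hx Hy Hxy; apply (eq_is_derive f x y); [|exact Hxy].
  intros t Ht; apply Hf, (HD x y t Hx Hy Ht). }
intros x y Hx Hy; destruct (Rtotal_order x y) as [h|[h|h]];
  [|now rewrite h|symmetry]; apply H; assumption.
Qed.

(** In a horizontal plane with normal [k ez], [k = 1] or [k = -1], this sends the first frame vector
    to the second; [k] records the orientation. *)
Definition quarter_turn (k : R) (v : R3) : R3 := vscal k (cross ez v).

Lemma is_vderive_quarter_turn (k : R) (f : R -> R3) (s : R) (f' : R3) :
  is_vderive f s f' ->
  is_vderive (fun x => quarter_turn k (f x)) s (quarter_turn k f').
Proof.
intros [H1 [H2 H3]].
assert (H : forall (g h : R -> R) (g' h' a b : R), is_derive g s g' ->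
  is_derive h s h' ->
  is_derive (fun x => k * (a * g x - b * h x)) s (k * (a * g' - b * h'))).
{ intros g h g' h' a b G G'; auto_derive; [repeat split; eexists; eassumption|].
  rewrite (Derive_eq _ _ _ G), (Derive_eq _ _ _ G'); ring. }
split; [|split]; apply H; assumption.
Qed.

(** The degree falls from 5 to 1 because each of the three products has a factor constant in [t]:
    [h_tt], [<X_st,N>] and [<X_tt,N>] only involve vectors turning at the same rate. The other
    factors are affine in [cos t] and [sin t]. *)
Lemma horizontal_laplace_affine (k : R) (c' c'' u u' u'' : R3) :
  k = 1 \/ k = -1 -> c3 u = 0 -> c3 u' = 0 -> c3 u'' = 0 ->
  exists q0 q1 q2, forall t,
  laplace_numerator
    (harmonic c' u' (quarter_turn k u') t)
    (harmonic v0 (quarter_turn k u) (vscal (-1) u) t)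
    (harmonic c'' u'' (quarter_turn k u'') t)
    (harmonic v0 (quarter_turn k u') (vscal (-1) u') t)
    (harmonic v0 (vscal (-1) u) (vscal (-1) (quarter_turn k u)) t) =
  q0 + q1 * cos t + q2 * sin t.
Proof.
intros Hk Hu Hu' Hu''.
(* With [x = cos t] and [y = sin t], [W d w] is the third coordinate of the cross product of
   [harmonic d w (quarter_turn k w) t] with [X_t]; [E] and [F] are [h_ss] and [h_st], and [L] is the
   whole expression. *)
pose (W (d w : R3) (x y : R) := k * hdot w u + x * (k * hdot d u)
  + y * (c2 d * c1 u - c1 d * c2 u)).
pose (E (x y : R) := hdot c' c' + hdot u' u' + 2 * (x * hdot c' u'
  + y * hdot c' (quarter_turn k u'))).
pose (F (x y : R) := x * hdot c' (quarter_turn k u) - y * hdot c' u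
  + hdot u' (quarter_turn k u)).
pose (L (x y : R) := hdot u u * (c3 c'' * W c' u' x y - c3 c' * W c'' u'' x y)
  + 2 * F x y * (c3 c' * (c1 u' * c2 u - c2 u' * c1 u))
  + E x y * (c3 c' * (k * hdot u u))).
(* [L] is affine in [x] and [y], so its coefficients are read off at three points. *)
exists (L 0 0), (L 1 0 - L 0 0), (L 0 1 - L 0 0); intros t.
assert (Hcs := sin2_cos2 t); unfold Rsqr in Hcs.
transitivity (L (cos t) (sin t)); [|unfold L, E, F, W; ring].
unfold laplace_numerator, harmonic.
revert Hcs; generalize (cos t) (sin t); intros x y Hcs.
assert (Hyy : y * y = 1 - x * x) by lra.
destruct c' as [[d1 d2] d3], c'' as [[f1 f2] f3], u as [[u1 u2] u3],
  u' as [[v1 v2] v3], u'' as [[w1 w2] w3].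
unfold c3 in Hu, Hu', Hu''; cbn [snd] in Hu, Hu', Hu''; subst u3 v3 w3.
cbv zeta; set (p := vadd (d1, d2, d3) _); set (q := vadd v0 _).
assert (Eq : cross p q = (- d3 * c2 q, d3 * c1 q, W (d1, d2, d3) (v1, v2, 0) x y)).
{ unfold W, p, q, quarter_turn, v0; destruct Hk as [-> | ->]; coords;
  (apply (f_equal2 pair); [apply (f_equal2 pair)|]; ring [Hyy]). }
rewrite Eq.
assert (EG : hdot q q = hdot (u1, u2, 0) (u1, u2, 0)).
{ unfold q, quarter_turn, v0; destruct Hk as [-> | ->]; coords; ring [Hyy]. }
assert (EF : hdot p q = F x y).
{ unfold F, p, q, quarter_turn, v0; destruct Hk as [-> | ->]; coords; ring [Hyy]. }
assert (EE : hdot p p = E x y).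
{ unfold E, p, quarter_turn, v0; destruct Hk as [-> | ->]; coords; ring [Hyy]. }
rewrite EG, EF, EE.
unfold L; clearbody E F.
unfold q, p, W, quarter_turn, v0; destruct Hk as [-> | ->]; coords; ring [Hyy].
Qed.

Lemma horizontal_normal_affine (k : R) (c' u u' : R3) (t : R) :
  k = 1 \/ k = -1 ->
  c3 (cross (harmonic c' u' (quarter_turn k u') t)
            (harmonic v0 (quarter_turn k u) (vscal (-1) u) t)) =
  k * hdot u' u + k * hdot c' u * cos t + (c2 c' * c1 u - c1 c' * c2 u) * sin t.
Proof.
intros Hk; assert (Hcs := sin2_cos2 t); unfold Rsqr in Hcs.
unfold harmonic; revert Hcs; generalize (cos t) (sin t); intros x y Hcs.
assert (Hyy : y * y = 1 - x * x) by lra.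
unfold quarter_turn, v0; destruct Hk as [-> | ->]; coords; ring [Hyy].
Qed.

(** Here [N_3] has degree 1, and [Q], of degree 1, fits the bound [pred (3 * 1) = 2]. The vanishing
    leading coefficient of [N_3] says that the horizontal part of [c'] is both orthogonal and
    collinear to [u], which is horizontal and nonzero. *)
Lemma horizontal_camc_center (Lambda k : R) (c' c'' u u' u'' : R3) :
  Lambda <> 0 -> k = 1 \/ k = -1 ->
  u <> v0 -> c3 u = 0 -> c3 u' = 0 -> c3 u'' = 0 ->
  let p := harmonic c' u' (quarter_turn k u') in
  let q := harmonic v0 (quarter_turn k u) (vscal (-1) u) in
  (forall t, c3 (cross (p t) (q t)) *
    (2 * laplace_numerator (p t) (q t)
       (harmonic c'' u'' (quarter_turn k u'') t)
       (harmonic v0 (quarter_turn k u') (vscal (-1) u') t)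
       (harmonic v0 (vscal (-1) u) (vscal (-1) (quarter_turn k u)) t)
     - Lambda * c3 (cross (p t) (q t)) ^ 3) = 0) ->
  c1 c' = 0 /\ c2 c' = 0.
Proof.
intros HL Hk Hu0 Hu Hu' Hu'' p q H.
destruct (horizontal_laplace_affine k c' c'' u u' u'' Hk Hu Hu' Hu'')
  as [q0 [q1 [q2 HQ]]].
assert (Hw : (k * hdot c' u / 2, (c2 c' * c1 u - c1 c' * c2 u) / 2) = RtoC 0).
{ apply (trigpoly_cube_lead 1 _ _ Lambda _ _ HL
    (trigpoly_affine (k * hdot u' u) _ _)
    (trigpoly_S _ _ _ (trigpoly_affine q0 q1 q2)) (le_n 1)).
  intros t; rewrite <- HQ, <- (horizontal_normal_affine k c' u u' t Hk); apply H. }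
injection Hw as Hre Him.
assert (H1 : c1 c' * c1 u + c2 c' * c2 u = 0).
{ fold (hdot c' u); destruct Hk as [-> | ->]; lra. }
assert (H2 : c2 c' * c1 u - c1 c' * c2 u = 0) by lra.
assert (Hn : c1 u * c1 u + c2 u * c2 u <> 0).
{ intros E; apply Hu0; destruct u as [[u1 u2] u3].
  unfold c1, c2, c3 in *; cbn [fst snd] in *; unfold v0.
  assert (u1 = 0) by nra; assert (u2 = 0) by nra; now subst. }
split; (apply (Rmult_eq_reg_r (c1 u * c1 u + c2 u * c2 u)); [|exact Hn]).
- transitivity (c1 u * (c1 c' * c1 u + c2 c' * c2 u)
    - c2 u * (c2 c' * c1 u - c1 c' * c2 u)); [ring|rewrite H1, H2; ring].
- transitivity (c2 u * (c1 c' * c1 u + c2 c' * c2 u)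
    + c1 u * (c2 c' * c1 u - c1 c' * c2 u)); [ring|rewrite H1, H2; ring].
Qed.

(** * Cyclic surfaces *)

Definition twice_derivable_on (D : R -> Prop) (f : R -> R) : Prop :=
  forall s, D s -> ex_derive f s /\ ex_derive (Derive f) s.

Definition vtwice_derivable_on (D : R -> Prop) (f : R -> R3) : Prop :=
  twice_derivable_on D (fun s => c1 (f s)) /\
  twice_derivable_on D (fun s => c2 (f s)) /\
  twice_derivable_on D (fun s => c3 (f s)).

Lemma smooth_twice_derivable (D : R -> Prop) (f : R -> R) :
  smooth_on D f -> twice_derivable_on D f.
Proof. intros H s Ds; split; [exact (H 1%nat s Ds)|exact (H 2%nat s Ds)]. Qed.

Lemma twice_derivable_mult (D : R -> Prop) (f g : R -> R) :
  (forall s, D s -> locally s D) ->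
  twice_derivable_on D f -> twice_derivable_on D g ->
  twice_derivable_on D (fun s => f s * g s).
Proof.
intros HD Hf Hg s Hs.
destruct (Hf s Hs) as [Hf1 Hf2], (Hg s Hs) as [Hg1 Hg2]; split.
- apply @ex_derive_mult; (assumption || exact Rmult_comm).
- apply ex_derive_ext_loc with (fun x => Derive f x * g x + f x * Derive g x).
  + eapply filter_imp; [|exact (HD s Hs)].
    intros x Hx; destruct (Hf x Hx), (Hg x Hx).
    symmetry; apply Derive_mult; assumption.
  + apply @ex_derive_plus; apply @ex_derive_mult; (assumption || exact Rmult_comm).
Qed.

Lemma vtwice_derivable_scal (D : R -> Prop) (r : R -> R) (f : R -> R3) :
  (forall s, D s -> locally s D) ->
  smooth_on D r -> vsmooth_on D f ->
  vtwice_derivable_on D (fun s => vscal (r s) (f s)).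
Proof.
intros HD Hr [H1 [H2 H3]]; split; [|split];
  (apply (twice_derivable_mult D r); [exact HD|..];
   apply smooth_twice_derivable; assumption).
Qed.

Lemma is_vderive_vDerive (D : R -> Prop) (f : R -> R3) (s : R) :
  vtwice_derivable_on D f -> D s ->
  is_vderive f s (vDerive f s) /\
  is_vderive (vDerive f) s (vDerive (vDerive f) s).
Proof.
intros [H1 [H2 H3]] Hs.
split; (split; [|split]); apply Derive_correct; apply H1 || apply H2 || apply H3;
  exact Hs.
Qed.

Lemma is_vderive_harmonic_angle (z x y : R3) (t : R) :
  is_vderive (harmonic z x y) t (harmonic v0 y (vscal (-1) x) t).
Proof.
assert (H : forall a b d : R,
  is_derive (fun u => a + (cos u * b + sin u * d)) t
    (0 + (cos t * d + sin t * (-1 * b)))) by (intros; auto_derive; [exact I|ring]).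
split; [|split]; apply H.
Qed.

Lemma is_vderive_harmonic_coefficients (z x y : R -> R3) (t s : R) (z' x' y' : R3) :
  is_vderive z s z' -> is_vderive x s x' -> is_vderive y s y' ->
  is_vderive (fun u => harmonic (z u) (x u) (y u) t) s (harmonic z' x' y' t).
Proof.
assert (H : forall (f g h : R -> R) (f' g' h' : R),
  is_derive f s f' -> is_derive g s g' -> is_derive h s h' ->
  is_derive (fun u => f u + (cos t * g u + sin t * h u)) s
    (f' + (cos t * g' + sin t * h'))).
{ intros f g h f' g' h' F G H; auto_derive; [repeat split; eexists; eassumption|].
  rewrite (Derive_eq _ _ _ F), (Derive_eq _ _ _ G), (Derive_eq _ _ _ H); ring. }
intros [Z1 [Z2 Z3]] [X1 [X2 X3]] [Y1 [Y2 Y3]].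
split; [|split]; apply H; assumption.
Qed.

Lemma circles_harmonic (c : R -> R3) (r : R -> R) (e1 e2 : R -> R3) (s t : R) :
  circles c r e1 e2 s t =
  harmonic (c s) (vscal (r s) (e1 s)) (vscal (r s) (e2 s)) t.
Proof. unfold circles, harmonic; vring. Qed.

Lemma Dt_circles (c : R -> R3) (r : R -> R) (e1 e2 : R -> R3) (s t : R) :
  Dt (circles c r e1 e2) s t =
  harmonic v0 (vscal (r s) (e2 s)) (vscal (-1) (vscal (r s) (e1 s))) t.
Proof.
apply vDerive_unique; eapply is_vderive_ext_loc; [|apply is_vderive_harmonic_angle].
apply filter_forall; intros u; symmetry; apply circles_harmonic.
Qed.

Section Circles.

Variables (D : R -> Prop) (c : R -> R3) (r : R -> R) (e1 e2 : R -> R3).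
Hypothesis D_open : forall s, D s -> locally s D.
Hypothesis cyclic : cyclic_surface D c r e1 e2.

Let X := circles c r e1 e2.
(** Absorbing the radius into the frame turns each circle into a [harmonic]. *)
Let U (s : R) : R3 := vscal (r s) (e1 s).
Let V (s : R) : R3 := vscal (r s) (e2 s).

Lemma center_twice_derivable : vtwice_derivable_on D c.
Proof.
destruct (cyclic_smooth_center _ _ _ _ _ cyclic) as [H1 [H2 H3]].
split; [|split]; apply smooth_twice_derivable; assumption.
Qed.

Lemma U_twice_derivable : vtwice_derivable_on D U.
Proof. apply vtwice_derivable_scal; [exact D_open|apply cyclic..]. Qed.

Lemma V_twice_derivable : vtwice_derivable_on D V.
Proof. apply vtwice_derivable_scal; [exact D_open|apply cyclic..]. Qed.

Lemma Ds_circles (s t : R) : D s ->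
  Ds X s t = harmonic (vDerive c s) (vDerive U s) (vDerive V s) t.
Proof.
intros Hs; apply vDerive_unique.
eapply is_vderive_ext_loc.
- apply filter_forall; intros u; symmetry; apply circles_harmonic.
- apply is_vderive_harmonic_coefficients.
  + apply (is_vderive_vDerive D c s center_twice_derivable Hs).
  + apply (is_vderive_vDerive D U s U_twice_derivable Hs).
  + apply (is_vderive_vDerive D V s V_twice_derivable Hs).
Qed.

(** This is [X_s x X_t] on the circle at [s], written out as an expression in [t]; [circle_laplace]
    does the same for [Q]. *)
Definition circle_normal (s t : R) : R3 :=
  cross (harmonic (vDerive c s) (vDerive U s) (vDerive V s) t)
        (harmonic v0 (V s) (vscal (-1) (U s)) t).

Definition circle_laplace (s t : R) : R :=
  laplace_numerator
    (harmonic (vDerive c s) (vDerive U s) (vDerive V s) t)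
    (harmonic v0 (V s) (vscal (-1) (U s)) t)
    (harmonic (vDerive (vDerive c) s) (vDerive (vDerive U) s)
       (vDerive (vDerive V) s) t)
    (harmonic v0 (vDerive V s) (vscal (-1) (vDerive U s)) t)
    (harmonic v0 (vscal (-1) (U s)) (vscal (-1) (V s)) t).

Lemma circles_camc_equation (Lambda s t : R) :
  constant_anisotropic_mean_curvature D X Lambda -> D s ->
  c3 (circle_normal s t) *
    (2 * circle_laplace s t - Lambda * c3 (circle_normal s t) ^ 3) = 0.
Proof.
intros [H _] Hs; specialize (H s t Hs).
destruct (is_vderive_vDerive D c s center_twice_derivable Hs) as [_ Hc].
destruct (is_vderive_vDerive D U s U_twice_derivable Hs) as [HU HU2].
destruct (is_vderive_vDerive D V s V_twice_derivable Hs) as [HV HV2].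
(* Where [N_3] vanishes the curvature hypothesis says nothing, but the extra factor [N_3] makes the
   equation trivial. *)
destruct (Req_dec (c3 (circle_normal s t)) 0) as [E|E]; [rewrite E; ring|].
assert (EN : cross (Ds X s t) (Dt X s t) = circle_normal s t).
{ unfold X; rewrite Dt_circles; fold X; rewrite Ds_circles by exact Hs.
  reflexivity. }
assert (Hl := anisotropic_mean_curvature_laplace X s t
  (harmonic (vDerive (vDerive c) s) (vDerive (vDerive U) s)
       (vDerive (vDerive V) s) t)
  (harmonic v0 (vDerive V s) (vscal (-1) (vDerive U s)) t)
  (harmonic v0 (vscal (-1) (U s)) (vscal (-1) (V s)) t)).
rewrite EN in Hl; rewrite H in Hl.
2: { unfold nu; rewrite EN; unfold vscal, c3 at 1; cbn [snd].
  assert (Hn := vnorm_pos _ E).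
  apply Rmult_integral_contrapositive_currified; [|exact E].
  apply Rinv_neq_0_compat; lra. }
cbv zeta in Hl; rewrite Hl; [|..|exact E].
- unfold X at 2; rewrite Dt_circles, Ds_circles by exact Hs.
  unfold circle_laplace, U, V; ring.
- eapply is_vderive_ext_loc;
    [|apply (is_vderive_harmonic_coefficients _ _ _ _ _ _ _ _ Hc HU2 HV2)].
  (* The formula for [Ds X] is known only over [D]; openness makes it hold near [s], so it can be
     differentiated in [s]. *)
  eapply filter_imp; [|exact (D_open s Hs)].
  intros u Hu; symmetry; apply Ds_circles, Hu.
- eapply is_vderive_ext_loc; [|apply is_vderive_harmonic_angle].
  apply filter_forall; intros u; symmetry; apply Ds_circles, Hs.
- eapply is_vderive_ext_loc.
  { apply filter_forall; intros u; symmetry; apply Dt_circles. }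
  apply is_vderive_harmonic_coefficients; [|exact HV|].
  + split; [|split]; apply @is_derive_const.
  + destruct HU as [H1 [H2 H3]].
    split; [|split]; apply is_derive_scal; assumption.
- eapply is_vderive_ext_loc.
  { apply filter_forall; intros u; symmetry; apply Dt_circles. }
  apply is_vderive_harmonic_angle.
Qed.

Lemma trigpoly_harmonic (z x y : R3) :
  trigpoly 1 (c1 x / 2, c1 y / 2) (fun t => c1 (harmonic z x y t)) /\
  trigpoly 1 (c2 x / 2, c2 y / 2) (fun t => c2 (harmonic z x y t)) /\
  trigpoly 1 (c3 x / 2, c3 y / 2) (fun t => c3 (harmonic z x y t)).
Proof.
assert (H : forall a b d : R,
  trigpoly 1 (b / 2, d / 2) (fun t => a + (cos t * b + sin t * d))).
{ intros a b d; eapply trigpoly_ext; [|apply (trigpoly_affine a b d)].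
  intros t; cbv beta; ring. }
split; [|split]; apply H.
Qed.

Lemma vtrigdeg_harmonic (z x y : R3) : vtrigdeg 1 (harmonic z x y).
Proof.
destruct (trigpoly_harmonic z x y) as [H1 [H2 H3]].
split; [|split]; eexists; eassumption.
Qed.

(** The leading coefficient is the third coordinate of the complex cross product of
    [(U' + i V') / 2] with [(V - i U) / 2]; its real and imaginary parts are listed, with the two
    halves giving the factor 4. *)
Lemma trigpoly_circle_normal (s : R) :
  exists w, trigpoly 2 w (fun t => c3 (circle_normal s t)) /\
   4 * fst w = c3 (vadd (cross (vDerive U s) (V s)) (cross (vDerive V s) (U s))) /\
   4 * snd w = c3 (vsub (cross (vDerive V s) (V s)) (cross (vDerive U s) (U s))).
Proof.
destruct (trigpoly_harmonic (vDerive c s) (vDerive U s) (vDerive V s))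
  as [P1 [P2 _]].
destruct (trigpoly_harmonic v0 (V s) (vscal (-1) (U s))) as [Q1 [Q2 _]].
assert (H := trigpoly_lin _ (-1) _ _ _ _
  (trigpoly_mul _ _ _ _ _ _ P1 Q2) (trigpoly_mul _ _ _ _ _ _ P2 Q1)).
eexists; split; [|split].
- eapply trigpoly_ext; [|exact H].
  intros t; unfold circle_normal, cross; generalize harmonic; intros h.
  coords; ring.
- coords; simpl; field.
- coords; simpl; field.
Qed.

(** * Constancy of the direction of the planes *)

Lemma circle_frame_condition (Lambda s : R) :
  constant_anisotropic_mean_curvature D X Lambda -> Lambda <> 0 -> D s ->
  c3 (vadd (cross (vDerive U s) (V s)) (cross (vDerive V s) (U s))) = 0 /\
  c3 (vsub (cross (vDerive V s) (V s)) (cross (vDerive U s) (U s))) = 0.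
Proof.
intros Hcamc HL Hs.
destruct (trigpoly_circle_normal s) as [w [Hw [<- <-]]].
destruct (trigdeg_laplace_numerator _ _ _ _ _
  (vtrigdeg_harmonic (vDerive c s) (vDerive U s) (vDerive V s))
  (vtrigdeg_harmonic v0 (V s) (vscal (-1) (U s)))
  (vtrigdeg_harmonic (vDerive (vDerive c) s) (vDerive (vDerive U) s)
       (vDerive (vDerive V) s))
  (vtrigdeg_harmonic v0 (vDerive V s) (vscal (-1) (vDerive U s)))
  (vtrigdeg_harmonic v0 (vscal (-1) (U s)) (vscal (-1) (V s)))) as [z Hz].
rewrite (trigpoly_cube_lead 2 w z Lambda _ _ HL Hw Hz).
- simpl; split; ring.
- lia.
- intros t; exact (circles_camc_equation Lambda s t Hcamc Hs).
Qed.

Lemma normal_derivative (Lambda s : R) :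
  constant_anisotropic_mean_curvature D X Lambda -> Lambda <> 0 -> D s ->
  exists n', is_vderive (plane_normal e1 e2) s n' /\ c3 n' = 0 /\
    vscal (1 - c3 (plane_normal e1 e2 s) ^ 2) n' = v0.
Proof.
intros Hcamc HL Hs.
assert (Hvd : forall e, vsmooth_on D e -> is_vderive e s (vDerive e s)).
{ intros e [H1 [H2 H3]].
  split; [|split]; apply Derive_correct;
    [apply (H1 1%nat)|apply (H2 1%nat)|apply (H3 1%nat)]; exact Hs. }
assert (He1 := Hvd e1 (cyclic_smooth_e1 _ _ _ _ _ cyclic)).
assert (He2 := Hvd e2 (cyclic_smooth_e2 _ _ _ _ _ cyclic)).
assert (Hr : is_derive r s (Derive r s)).
{ apply Derive_correct, (cyclic_smooth_radius _ _ _ _ _ cyclic 1%nat s Hs). }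
assert (Hr0 := cyclic_radius_pos _ _ _ _ _ cyclic s Hs).
assert (Ho := cyclic_orthonormal _ _ _ _ _ cyclic).
destruct (circle_frame_condition Lambda s Hcamc HL Hs) as [E1 E2].
assert (HU : vDerive U s = vadd (vscal (Derive r s) (e1 s)) (vscal (r s) (vDerive e1 s)))
  by (apply vDerive_unique, is_vderive_scal; assumption).
assert (HV : vDerive V s = vadd (vscal (Derive r s) (e2 s)) (vscal (r s) (vDerive e2 s)))
  by (apply vDerive_unique, is_vderive_scal; assumption).
rewrite HU, HV in E1, E2; unfold U, V in E1, E2; clear HU HV.
assert (Hz := fun f g k H => dot_constant_derive D f g s k
  (vDerive f s) (vDerive g s) (D_open s Hs) H).
assert (H11 := Hz e1 e1 1 (fun x Hx => proj1 (Ho x Hx)) He1 He1).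
assert (H22 := Hz e2 e2 1 (fun x Hx => proj1 (proj2 (Ho x Hx))) He2 He2).
assert (H12 := Hz e1 e2 0 (fun x Hx => proj2 (proj2 (Ho x Hx))) He1 He2).
exists (vadd (cross (vDerive e1 s) (e2 s)) (cross (e1 s) (vDerive e2 s))).
split; [apply is_vderive_cross; assumption|].
destruct (Ho s Hs) as [O1 [O2 O12]].
rewrite (dot_sym (e1 s)) in H11; rewrite (dot_sym (e2 s)) in H22.
apply orthonormal_frame_derivative; try assumption; try lra.
(* The terms with the derivative of [r] cancel since the cross product is alternating, so the
   conditions on [U] and [V] are [r ^ 2] times those on the frame. *)
- apply (Rmult_eq_reg_l (r s ^ 2)); [|nra].
  rewrite Rmult_0_r, <- E1; coords; ring.
- apply (Rmult_eq_reg_l (r s ^ 2)); [|nra].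
  rewrite Rmult_0_r, <- E2; coords; ring.
Qed.

Hypothesis D_convex : forall x y z, D x -> D y -> x <= z <= y -> D z.

(** Since [n'_3 = 0], the number [1 - n_3^2] is constant. If it is nonzero at one parameter it is
    nonzero at all of them, and then [n' = 0] throughout. This excludes a mixture of horizontal and
    tilted planes. *)
Lemma normal_constant (Lambda : R) :
  constant_anisotropic_mean_curvature D X Lambda -> Lambda <> 0 ->
  forall s s', D s -> D s' ->
  c3 (plane_normal e1 e2 s) = c3 (plane_normal e1 e2 s') /\
  (1 - c3 (plane_normal e1 e2 s) ^ 2 <> 0 ->
   plane_normal e1 e2 s = plane_normal e1 e2 s').
Proof.
intros Hcamc HL.
assert (H3 : forall x y, D x -> D y ->
  c3 (plane_normal e1 e2 x) = c3 (plane_normal e1 e2 y)).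
{ apply (constant_on_convex D _ D_convex); intros s Hs.
  destruct (normal_derivative Lambda s Hcamc HL Hs) as [n' [Hn [<- _]]]; apply Hn. }
intros s0 s' Hs0 Hs'; split; [exact (H3 s0 s' Hs0 Hs')|intros Hne].
assert (H : forall s, D s -> is_vderive (plane_normal e1 e2) s v0).
{ intros s Hs.
  destruct (normal_derivative Lambda s Hcamc HL Hs) as [n' [Hn [_ Hz]]].
  rewrite (H3 s s0 Hs Hs0) in Hz.
  replace v0 with n'; [exact Hn|].
  transitivity (vscal (/ (1 - c3 (plane_normal e1 e2 s0) ^ 2)) v0).
  - rewrite <- Hz; destruct n' as [[x y] z]; revert Hne.
    generalize (c3 (plane_normal e1 e2 s0)); intros k Hk; coords.
    apply (f_equal2 pair); [apply (f_equal2 pair)|]; now field.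
  - unfold v0; vring. }
apply injective_projections; [apply injective_projections|].
- apply (constant_on_convex D (fun x => c1 (plane_normal e1 e2 x)) D_convex);
    try assumption; apply H.
- apply (constant_on_convex D (fun x => c2 (plane_normal e1 e2 x)) D_convex);
    try assumption; apply H.
- exact (H3 s0 s' Hs0 Hs').
Qed.

Lemma camc_planes_parallel (Lambda : R) :
  constant_anisotropic_mean_curvature D X Lambda -> Lambda <> 0 ->
  parallel_planes D e1 e2.
Proof.
intros Hcamc HL s s' Hs Hs'.
destruct (normal_constant Lambda Hcamc HL s s' Hs Hs') as [H3 H].
destruct (Req_dec (1 - c3 (plane_normal e1 e2 s) ^ 2) 0) as [E|E].
2: { rewrite <- (H E); unfold v0; vring. }
(* In the remaining case all normals are unit vectors with [n_3^2 = 1], hence vertical, and any two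
   of them are collinear. *)
assert (Hh : forall x, D x -> c3 (plane_normal e1 e2 x) ^ 2 = 1 ->
  c1 (plane_normal e1 e2 x) = 0 /\ c2 (plane_normal e1 e2 x) = 0).
{ intros x Hx Ex; destruct (cyclic_orthonormal _ _ _ _ _ cyclic x Hx) as [O1 [O2 O12]].
  assert (On : dot (plane_normal e1 e2 x) (plane_normal e1 e2 x) = 1).
  { transitivity (dot (e1 x) (e1 x) * dot (e2 x) (e2 x) - dot (e1 x) (e2 x) ^ 2);
      [unfold plane_normal; coords; ring|rewrite O1, O2, O12; ring]. }
  unfold dot in On; split; nra. }
destruct (Hh s Hs) as [A1 A2]; [lra|].
destruct (Hh s' Hs') as [B1 B2]; [rewrite <- H3; lra|].
unfold cross; rewrite A1, A2, B1, B2; unfold v0.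
apply (f_equal2 pair); [apply (f_equal2 pair)|]; ring.
Qed.

(** * Foliations by horizontal circles *)

Lemma horizontal_frame (s : R) :
  D s -> cross (plane_normal e1 e2 s) ez = v0 ->
  c3 (plane_normal e1 e2 s) ^ 2 = 1 /\ c3 (e1 s) = 0 /\
  e2 s = quarter_turn (c3 (plane_normal e1 e2 s)) (e1 s).
Proof.
intros Hs Hz; destruct (cyclic_orthonormal _ _ _ _ _ cyclic s Hs) as [O1 [O2 O12]].
assert (En := orthonormal_normal_z _ _ O1 O2 O12).
assert (On : dot (plane_normal e1 e2 s) (plane_normal e1 e2 s) = 1).
{ transitivity (dot (e1 s) (e1 s) * dot (e2 s) (e2 s) - dot (e1 s) (e2 s) ^ 2);
    [unfold plane_normal; coords; ring|rewrite O1, O2, O12; ring]. }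
(* As [e2 = n x e1], a vertical [n] makes [e2] a quarter turn of [e1], in the sense given by
   [n_3]. *)
assert (Ec : e2 s = cross (plane_normal e1 e2 s) (e1 s)).
{ unfold plane_normal; rewrite cross_anti, cross_cross, O1, O12.
  destruct (e2 s) as [[x y] z]; vring. }
fold (plane_normal e1 e2 s) in En; revert Hz En On Ec.
generalize (plane_normal e1 e2 s); intros [[n1 n2] n3]; unfold v0; coords.
intros Hz; injection Hz as Hz1 Hz2.
assert (n1 = 0) by lra; assert (n2 = 0) by lra; subst n1 n2; intros En On Ec.
assert (Hn : n3 * n3 = 1) by lra.
split; [lra|split; [nra|]].
rewrite Ec; destruct (e1 s) as [[x y] z]; unfold quarter_turn; vring.
Qed.

Lemma horizontal_centers (Lambda k : R) :
  constant_anisotropic_mean_curvature D X Lambda -> Lambda <> 0 ->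
  k = 1 \/ k = -1 ->
  (forall s, D s -> c3 (e1 s) = 0 /\ e2 s = quarter_turn k (e1 s)) ->
  forall s, D s -> c1 (vDerive c s) = 0 /\ c2 (vDerive c s) = 0.
Proof.
intros Hcamc HL Hk He s Hs.
assert (HU3 : forall x, D x -> c3 (U x) = 0).
{ intros x Hx; transitivity (r x * c3 (e1 x)); [reflexivity|].
  rewrite (proj1 (He x Hx)); ring. }
assert (HV : forall x, D x -> V x = quarter_turn k (U x)).
{ intros x Hx; unfold V, U; rewrite (proj2 (He x Hx)).
  unfold quarter_turn; vring. }
(* The relations [V = quarter_turn k U] and [c3 U = 0] hold on the open set [D], so they pass to
   first and second derivatives. *)
assert (Hlift : forall (f g : R -> R3) f', (forall x, D x -> g x = quarter_turn k (f x)) ->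
  forall x, D x -> is_vderive f x f' -> vDerive g x = quarter_turn k f').
{ intros f g f' Hfg x Hx Hf; apply vDerive_unique.
  eapply is_vderive_ext_loc; [|apply is_vderive_quarter_turn; exact Hf].
  eapply filter_imp; [|exact (D_open x Hx)].
  intros y Hy; symmetry; exact (Hfg y Hy). }
assert (Hzero : forall f : R -> R3, (forall x, D x -> c3 (f x) = 0) ->
  forall x, D x -> c3 (vDerive f x) = 0).
{ intros f Hf x Hx; transitivity (Derive (fun _ => 0) x); [|apply Derive_const].
  apply Derive_ext_loc; eapply filter_imp; [|exact (D_open x Hx)]; exact Hf. }
assert (HV' : forall x, D x -> vDerive V x = quarter_turn k (vDerive U x)).
{ intros x Hx; apply (Hlift U); try assumption.
  apply (is_vderive_vDerive D U x U_twice_derivable Hx). }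
assert (HV'' : vDerive (vDerive V) s = quarter_turn k (vDerive (vDerive U) s)).
{ apply (Hlift (vDerive U)); try assumption.
  apply (is_vderive_vDerive D U s U_twice_derivable Hs). }
assert (HU3' := Hzero U HU3); assert (HU3'' := Hzero _ HU3').
apply (horizontal_camc_center Lambda k (vDerive c s) (vDerive (vDerive c) s)
  (U s) (vDerive U s) (vDerive (vDerive U) s)); auto.
- destruct (cyclic_orthonormal _ _ _ _ _ cyclic s Hs) as [O1 _].
  assert (Hr := cyclic_radius_pos _ _ _ _ _ cyclic s Hs).
  intros E; assert (E' : dot (U s) (U s) = r s ^ 2 * dot (e1 s) (e1 s))
    by (unfold U; coords; ring).
  rewrite E, O1 in E'; revert E'; unfold v0; coords; nra.
- intros t; generalize (circles_camc_equation Lambda s t Hcamc Hs).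
  unfold circle_normal, circle_laplace; rewrite HV'', (HV' s Hs), (HV s Hs).
  exact (fun h => h).
Qed.

Lemma horizontal_revolution (Lambda : R) :
  constant_anisotropic_mean_curvature D X Lambda -> Lambda <> 0 ->
  planes_parallel_to_xy D e1 e2 -> surface_of_revolution (trace_of D X).
Proof.
intros Hcamc HL Hxy.
destruct (classic (exists s0, D s0)) as [[s0 Hs0]|HD].
(* Over an empty parameter interval the trace is empty, and any axis will do. *)
2: { exists v0, ez; split; [coords; ring|].
  intros phi q [s [t [Hs _]]]; case HD; now exists s. }
set (k := c3 (plane_normal e1 e2 s0)).
assert (Hk : k = 1 \/ k = -1).
{ destruct (horizontal_frame s0 Hs0 (Hxy s0 Hs0)) as [H _]; fold k in H.
  assert (Hf : (k - 1) * (k + 1) = 0) by lra.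
  apply Rmult_integral in Hf; lra. }
(* Constancy of [n_3] lets the one sign [k], taken at [s0], serve for every circle. *)
assert (He : forall s, D s -> c3 (e1 s) = 0 /\ e2 s = quarter_turn k (e1 s)).
{ intros s Hs; unfold k.
  rewrite (proj1 (normal_constant Lambda Hcamc HL s0 s Hs0 Hs)).
  apply (horizontal_frame s Hs (Hxy s Hs)). }
assert (Hc := horizontal_centers Lambda k Hcamc HL Hk He).
assert (Hc' := fun s Hs => is_vderive_vDerive D c s center_twice_derivable Hs).
assert (Hc1 : forall s, D s -> c1 (c s) = c1 (c s0)).
{ intros s Hs; apply (constant_on_convex D (fun x => c1 (c x)) D_convex);
    try assumption.
  intros x Hx; rewrite <- (proj1 (Hc x Hx)); apply (Hc' x Hx). }
assert (Hc2 : forall s, D s -> c2 (c s) = c2 (c s0)).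
{ intros s Hs; apply (constant_on_convex D (fun x => c2 (c x)) D_convex);
    try assumption.
  intros x Hx; rewrite <- (proj2 (Hc x Hx)); apply (Hc' x Hx). }
(* All centres lie on one vertical line, which is the axis. A rotation by [phi] about it preserves
   each circle and shifts its parameter by [k * phi], the sign being the orientation of the
   frame. *)
exists (c1 (c s0), c2 (c s0), 0), ez; split; [coords; ring|].
intros phi q [s [t [Hs ->]]]; exists s, (t + k * phi); split; [exact Hs|].
unfold X; rewrite !circles_harmonic.
destruct (He s Hs) as [He3 ->]; rewrite <- (Hc1 s Hs), <- (Hc2 s Hs).
unfold rotation, harmonic; cbv zeta.
assert (Ecos : cos (t + k * phi) = cos t * cos phi - k * (sin t * sin phi)).
{ destruct Hk as [-> | ->]; [rewrite Rmult_1_l, cos_plus; ring|].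
  replace (t + -1 * phi) with (t - phi) by ring; rewrite cos_minus; ring. }
assert (Esin : sin (t + k * phi) = sin t * cos phi + k * (cos t * sin phi)).
{ destruct Hk as [-> | ->]; [rewrite Rmult_1_l, sin_plus; ring|].
  replace (t + -1 * phi) with (t - phi) by ring; rewrite sin_minus; ring. }
rewrite Ecos, Esin; clear Ecos Esin He Hc Hc' Hc1 Hc2; clearbody k.
destruct (e1 s) as [[x y] z], (c s) as [[a b] d].
unfold c3 in He3; cbn [snd] in He3; subst z.
unfold quarter_turn.
generalize (cos t) (sin t) (cos phi) (sin phi) (r s); intros.
destruct Hk as [-> | ->]; vring.
Qed.

End Circles.

Theorem theorem1p5 (a b : Rbar)
    (c : R -> R3) (r : R -> R) (e1 e2 : R -> R3) (Lambda : R)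
    (Hcyclic : cyclic_surface (open_itv a b) c r e1 e2)
    (Hcamc : constant_anisotropic_mean_curvature
               (open_itv a b) (circles c r e1 e2) Lambda)
    (HLambda : Lambda <> 0) :
  parallel_planes (open_itv a b) e1 e2 /\
  (planes_parallel_to_xy (open_itv a b) e1 e2 ->
   surface_of_revolution (trace_of (open_itv a b) (circles c r e1 e2))).
Proof.
assert (Hopen : forall s, open_itv a b s -> locally s (open_itv a b)).
{ intros s [Ha Hb]; apply (locally_interval _ s a b Ha Hb).
  intros y Hy1 Hy2; split; assumption. }
assert (Hconvex : forall x y z, open_itv a b x -> open_itv a b y ->
  x <= z <= y -> open_itv a b z).
{ intros x y z [Hx _] [_ Hy] [H1 H2]; split.
  - exact (Rbar_lt_le_trans a x z Hx H1).
  - exact (Rbar_le_lt_trans z y b H2 Hy). }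
split.
- exact (camc_planes_parallel _ _ _ _ _ Hopen Hcyclic Hconvex Lambda Hcamc HLambda).
- exact (horizontal_revolution _ _ _ _ _ Hopen Hcyclic Hconvex Lambda Hcamc HLambda).
Qed.
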